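(* Let $D$ be a Mori domain. Then $D$ is $w$-divisorial if and only if $D[X]$ is $w$-divisorial.
   Context: For a domain $D$ with quotient field $K$ and fractional ideals $I,J$: $(I:J)=\{x\in K\mid xJ\subseteq I\}$. For a nonzero fractional ideal $I$: $I^{-1}=(D:I)$, $I_v=(I^{-1})^{-1}$, and $I_w=\bigcup (I:J)$, the union being over all finitely generated ideals $J$ of $D$ with $J_v=D$. A nonzero ideal $I$ is divisorial if $I=I_v$ and a $w$-ideal if $I=I_w$. A domain is $w$-divisorial if each of its $w$-ideals is divisorial. A Mori domain is a domain satisfying the ascending chain condition on integral divisorial ideals. $D[X]$ is the polynomial ring in one indeterminate. *)

(* Defs.v *)
From HB Require Import structures.
From mathcomp Require Import all_boot all_order all_algebra.
From mathcomp Require Import classical_sets.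

Set Implicit Arguments.
Unset Strict Implicit.
Unset Printing Implicit Defensive.

Import GRing.Theory.
Local Open Scope ring_scope.
Local Open Scope classical_set_scope.

(* All ideals of a domain D, integral or not, are represented as subsets of
   its quotient field {fraction D}; D itself is the range of tofrac. *)

Section Ideals.
Variable D : idomainType.
Local Notation K := {fraction D}.
Implicit Types I J : set K.

Definition base_domain : set K := range (@tofrac D).

Definition is_submodule I : Prop :=
  [/\ I 0, forall x y, I x -> I y -> I (x + y)
    & forall (a : D) x, I x -> I (tofrac a * x)].

Definition fractional_ideal I : Prop :=
  is_submodule I /\
  exists2 d : D, d != 0 & forall x, I x -> base_domain (tofrac d * x).

Definition integral_ideal I : Prop :=
  is_submodule I /\ I `<=` base_domain.

Definition nonzero_set I : Prop := exists2 x, I x & x != 0.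

Definition finitely_generated I : Prop :=
  exists s : seq K,
    I = [set x | exists c : 'I_(size s) -> D,
                   x = \sum_(i < size s) tofrac (c i) * s`_i].

Definition colon I J : set K := [set x | forall y, J y -> I (x * y)].

Definition inv_ideal I : set K := colon base_domain I.

Definition v_closure I : set K := inv_ideal (inv_ideal I).

(* J is nonzero because J_v only makes sense for nonzero J: with the total
   operations above, inv_ideal of the zero ideal is all of K. *)
Definition w_closure I : set K :=
  \bigcup_(J in [set J | [/\ integral_ideal J, finitely_generated J,
                             nonzero_set J & v_closure J = base_domain]])
    colon I J.

Definition divisorial_ideal I : Prop :=
  [/\ fractional_ideal I, nonzero_set I & I = v_closure I].

Definition w_ideal I : Prop :=
  [/\ fractional_ideal I, nonzero_set I & I = w_closure I].

End Ideals.

Definition w_divisorial_domain (D : idomainType) : Prop :=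
  forall I : set {fraction D}, w_ideal I -> divisorial_ideal I.

Definition mori_domain (D : idomainType) : Prop :=
  forall I : nat -> set {fraction D},
    (forall n, integral_ideal (I n) /\ divisorial_ideal (I n)) ->
    (forall n, I n `<=` I n.+1) ->
    exists N : nat, forall n, (N <= n)%N -> I n = I N.

(* Main.v *)
(* Write K for the quotient field of D, let N be the set of nonzero polynomials
   g over D with c(g)_v = D, and say that x in K is in I_w when x g has
   coefficients in I for some g in N.  If I is a w-ideal, g is in N and g h has
   coefficients in I, then so has h.

   If D[X] is w-divisorial and I is a w-ideal of D, this property makes I[X] a
   w-ideal, and (I[X])_v = I_v[X].

   Conversely let D be Mori and w-divisorial, so that w-ideals and divisorial
   ideals coincide.  The leading coefficient argument of Hilbert's basis theorem
   shows that for f nonzero the polynomials h over K with f h in D[X] have a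
   common denominator; hence a w-ideal of D[X] is, up to a factor in K(X), an
   ideal T of D[X] containing some nonzero a in D and such that g h in T with g
   in N implies h in T.  One proves that T_v = T for all such T inside J[X], J
   divisorial and containing a, by Noetherian induction on J: the Mori property
   gives the maximum condition, and the duality J -> a J^-1 the minimum condition.
   In the induction step I is a maximal divisorial ideal with a in I < J.  The
   quotients J/I and M^-1/D, with M = (I : y) for y in J outside I, are simple up
   to the w-operation, and they remain so over D[X] after inverting N. *)

Require Import Defs.
From HB Require Import structures.
From mathcomp Require Import all_boot all_order all_algebra.
From mathcomp Require Import ring.
From mathcomp Require Import boolp classical_sets.

Set Implicit Arguments.
Unset Strict Implicit.
Unset Printing Implicit Defensive.

Import GRing.Theory.
Local Open Scope ring_scope.
Local Open Scope classical_set_scope.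

(** * Submodules of the quotient field and the w-operation *)

Section QuotientField.
Variable D : idomainType.
Local Notation K := {fraction D}.

Lemma fraction_repr (x : K) : x = tofrac \n_(repr x) / tofrac \d_(repr x).
Proof.
rewrite -[x in LHS]reprK; set r := repr x.
have d0 : tofrac \d_r != 0 :> K by rewrite tofrac_eq0 denom_ratioP.
apply: (mulIf d0); rewrite mulfVK //.
apply/eqP; rewrite -[_ * _]/(FracField.mul _ _) !piE FracField.equivfE.
rewrite /FracField.mulf !numden_Ratio ?mulr1 ?oner_eq0 ?denom_ratioP //.
by rewrite mulrC.
Qed.

Lemma fractionP (x : K) :
  exists n d : D, d != 0 /\ x = tofrac n / tofrac d.
Proof.
exists \n_(repr x), \d_(repr x); split; first exact: denom_ratioP.
exact: fraction_repr.
Qed.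

Lemma base0 : base_domain (0 : K).
Proof. by exists 0; rewrite // tofrac0. Qed.

Lemma base1 : base_domain (1 : K).
Proof. by exists 1; rewrite // tofrac1. Qed.

Lemma baseD (x y : K) : base_domain x -> base_domain y -> base_domain (x + y).
Proof. by move=> [a _ <-] [b _ <-]; exists (a + b); rewrite // tofracD. Qed.

Lemma baseM (x y : K) : base_domain x -> base_domain y -> base_domain (x * y).
Proof. by move=> [a _ <-] [b _ <-]; exists (a * b); rewrite // tofracM. Qed.

Lemma base_submodule : is_submodule (@base_domain D).
Proof.
split; [exact: base0 | exact: baseD |].
by move=> a x; apply: baseM; exists a.
Qed.

Section Submodule.
Variable I : set K.
Hypothesis hI : is_submodule I.

Lemma submodule0 : I 0. Proof. by case: hI. Qed.

Lemma submoduleD x y : I x -> I y -> I (x + y). Proof. by case: hI => _ + _; apply. Qed.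

Lemma submoduleM a x : base_domain a -> I x -> I (a * x).
Proof. by case: hI => _ _ + [b _ <-]; apply. Qed.

Lemma submoduleMr a x : base_domain a -> I x -> I (x * a).
Proof. by rewrite mulrC; apply: submoduleM. Qed.

Lemma submoduleN x : I x -> I (- x).
Proof.
move=> Ix; rewrite -mulN1r; apply: submoduleM => //.
by exists (-1); rewrite // tofracN tofrac1.
Qed.

Lemma submoduleB x y : I x -> I y -> I (x - y).
Proof. by move=> Ix Iy; apply: submoduleD => //; apply: submoduleN. Qed.

Lemma submodule_sum (A : Type) (r : seq A) (P : pred A) (F : A -> K) :
  (forall i, P i -> I (F i)) -> I (\sum_(i <- r | P i) F i).
Proof. by move=> IF; apply: big_ind => //; [exact: submodule0 | exact: submoduleD]. Qed.

End Submodule.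

Lemma inv_submodule (I : set K) : is_submodule (inv_ideal I).
Proof.
split=> [y _|x y Ix Iy z Iz|a x Ix z Iz].
- by rewrite mul0r; apply: base0.
- by rewrite mulrDl; apply: baseD; [apply: Ix | apply: Iy].
- by rewrite -mulrA; apply: baseM; [exists a | apply: Ix].
Qed.

Lemma inv_ideal_anti (I J : set K) : I `<=` J -> inv_ideal J `<=` inv_ideal I.
Proof. by move=> sIJ x Jx y /sIJ; apply: Jx. Qed.

Lemma sub_v_closure (I : set K) : I `<=` v_closure I.
Proof. by move=> x Ix y; rewrite mulrC; apply. Qed.

Lemma inv_v_closure (I : set K) : inv_ideal (v_closure I) = inv_ideal I.
Proof.
apply/seteqP; split; first exact/inv_ideal_anti/sub_v_closure.
exact: sub_v_closure.
Qed.

Lemma inv_base : inv_ideal (@base_domain D) = @base_domain D.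
Proof.
apply/seteqP; split=> x hx; first by rewrite -[x]mulr1; apply: hx; apply: base1.
by move=> y; apply: baseM.
Qed.

Lemma v_closure_mono (I J : set K) : I `<=` J -> v_closure I `<=` v_closure J.
Proof. by move=> sIJ; do 2 apply: inv_ideal_anti. Qed.

(** * Contents of polynomials and the w-closure *)

Definition coefs_in (I : set K) : set {poly K} := [set p | forall i, I p`_i].

Section CoefsIn.
Variable I : set K.
Hypothesis hI : is_submodule I.

Lemma coefs0 : coefs_in I 0.
Proof. by move=> i; rewrite coef0; apply: submodule0. Qed.

Lemma coefsD p q : coefs_in I p -> coefs_in I q -> coefs_in I (p + q).
Proof. by move=> Ip Iq i; rewrite coefD; apply: submoduleD. Qed.

Lemma coefsB p q : coefs_in I p -> coefs_in I q -> coefs_in I (p - q).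
Proof. by move=> Ip Iq i; rewrite coefB; apply: submoduleB. Qed.

Lemma coefsM p q :
  coefs_in (@base_domain D) p -> coefs_in I q -> coefs_in I (p * q).
Proof.
by move=> Dp Iq i; rewrite coefM; apply: submodule_sum => // j _; apply: submoduleM.
Qed.

Lemma coefsC x : I x -> coefs_in I x%:P.
Proof. by move=> Ix i; rewrite coefC; case: eqP => _ //; apply: submodule0. Qed.

Lemma coefsZX x n : I x -> coefs_in I (x *: 'X^n).
Proof.
move=> Ix i; rewrite coefZ coefXn; case: eqP => _; rewrite ?mulr1 ?mulr0 //.
exact: submodule0.
Qed.

Lemma coefsZ a p : base_domain a -> coefs_in I p -> coefs_in I (a *: p).
Proof. by move=> Da Ip i; rewrite coefZ; apply: submoduleM. Qed.

End CoefsIn.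

Lemma base_coefsX n : coefs_in (@base_domain D) 'X^n.
Proof. by rewrite -['X^n]scale1r; apply: (coefsZX base_submodule); apply: base1. Qed.

Lemma coefs_in_sub (I J : set K) : I `<=` J -> coefs_in I `<=` coefs_in J.
Proof. by move=> sIJ p Ip i; apply/sIJ. Qed.

(* Polynomials encode finitely generated ideals by their content; [g] is a
   unit content polynomial when c(g)_v = D. *)
Definition unit_content (g : {poly K}) : Prop :=
  [/\ coefs_in (@base_domain D) g, g != 0
    & forall x, coefs_in (@base_domain D) (x *: g) -> base_domain x].

Definition w_hull (I : set K) : set K :=
  [set x | exists2 g, unit_content g & coefs_in I (x *: g)].

Definition w_closed (I : set K) : Prop := w_hull I `<=` I.

Lemma base_w_closed : w_closed (@base_domain D).
Proof. by move=> x [g [_ _]]; apply. Qed.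

Lemma span_nth (s : seq K) i : exists c : 'I_(size s) -> D,
  s`_i = \sum_(j < size s) tofrac (c j) * s`_j.
Proof.
have [lt_is|le_si] := ltnP i (size s); last first.
  exists (fun _ => 0); rewrite nth_default // big1 // => j _.
  by rewrite tofrac0 mul0r.
exists (fun j => if j == Ordinal lt_is then 1 else 0).
rewrite (bigD1 (Ordinal lt_is)) //= eqxx tofrac1 mul1r big1 ?addr0 //.
by move=> j /negPf ->; rewrite tofrac0 mul0r.
Qed.

(** Generators of J and coefficients of a polynomial are interchangeable, and J_v = D amounts to
    J^-1 = D, which is the last clause of [unit_content]. *)
Lemma w_closureE (I : set K) : is_submodule I -> w_closure I = w_hull I.
Proof.
move=> hI; apply/seteqP; split=> x.
- move=> [J [[_ JD] [s Js] [z Jz z0] Jv] xJ].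
  have Js_nth i : J s`_i by rewrite Js; apply: span_nth.
  have coefs i : (Poly s)`_i = s`_i by rewrite coef_Poly.
  exists (Poly s); last by move=> i; rewrite coefZ coefs; apply: xJ.
  split=> [i||y yg].
  + by rewrite coefs; apply: JD.
  + apply/eqP => s0; case/eqP: z0; move: Jz; rewrite Js => -[c ->].
    by rewrite big1 // => i _; rewrite -coefs s0 coef0 mulr0.
  + rewrite -inv_base -Jv inv_v_closure => w; rewrite Js => -[c ->].
    rewrite mulr_sumr; apply: (submodule_sum base_submodule) => i _.
    rewrite mulrCA; apply: baseM; first by exists (c i).
    by rewrite -coefs -coefZ; apply: yg.
- move=> [g [Dg g0 gu] xg].
  pose J : set K := [set y | exists c : 'I_(size g) -> D,
                   y = \sum_(i < size g) tofrac (c i) * (g : seq K)`_i].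
  have Jg i : J g`_i by apply: span_nth.
  have JD : J `<=` @base_domain D.
    move=> _ [c ->]; apply: (submodule_sum base_submodule) => i _.
    by apply: baseM => //; exists (c i).
  exists J; last first.
    move=> _ [c ->]; rewrite mulr_sumr; apply: (submodule_sum hI) => i _.
    by rewrite mulrCA -coefZ; apply: (submoduleM hI) => //; exists (c i).
  split=> //.
  + split=> //; split.
    * by exists (fun _ => 0); rewrite big1 // => j _; rewrite tofrac0 mul0r.
    * move=> _ _ [c ->] [d ->]; exists (fun i => c i + d i).
      by rewrite -big_split; apply: eq_bigr => i _; rewrite tofracD mulrDl.
    * move=> a _ [c ->]; exists (fun i => a * c i).
      by rewrite mulr_sumr; apply: eq_bigr => i _; rewrite tofracM mulrA.
  + by exists g.
  + by exists (lead_coef g); rewrite ?lead_coef_eq0 //; apply: Jg.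
  + rewrite /v_closure -[RHS]inv_base; congr inv_ideal.
    apply/seteqP; split=> y yJ; last by move=> z /JD; apply: baseM.
    by apply: gu => i; rewrite coefZ; apply: yJ; apply: Jg.
Qed.

(* Induction on the size of [h]: if all the products with later coefficients
   [g`_k] are already settled, the coefficient of index [j + deg h] of [g * h]
   shows that [g`_j * lead_coef h] lies in [I], so that [g`_j *: h] can be
   replaced by a polynomial of smaller size. *)
Lemma coefs_in_divl (I : set K) g h :
  is_submodule I -> w_closed I -> unit_content g ->
  coefs_in I (g * h) -> coefs_in I h.
Proof.
move=> hI wI ug; have [Dg _ _] := ug.
move: {2}(size h) (leqnn (size h)) => n; elim: n h => [|n IHn] h.
  by rewrite leqn0 size_poly_eq0 => /eqP-> _; apply: coefs0.
move=> szh Igh.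
have gjh m : forall j, (size g <= j + m)%N -> coefs_in I (g`_j *: h).
  elim: m => [|m IHm] j.
    by rewrite addn0 => /leq_sizeP-> //; rewrite scale0r; apply: coefs0.
  move=> szj.
  have Ijn : I (g`_j * h`_n).
    have := Igh (j + n)%N.
    have lt_j : (j < (j + n).+1)%N by rewrite ltnS leq_addr.
    rewrite coefM (bigD1 (Ordinal lt_j)) //= addKn => Is.
    rewrite -[_ * _](addrK (\sum_(i < (j + n).+1 | i != Ordinal lt_j)
                              g`_i * h`_(j + n - i))).
    apply: submoduleB => //; apply: (submodule_sum hI) => i /negPf ij.
    have [lt_ji|] := ltnP j i.
      rewrite -coefZ; apply: IHm; apply: leq_trans szj _.
      by rewrite addnS -addSn leq_add2r.
    rewrite leq_eqVlt -val_eqE /= in ij *; rewrite ij /= => lt_ij.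
    rewrite [h`_(_ - i)]nth_default ?mulr0; first exact: submodule0.
    rewrite -addnBAC ?(ltnW lt_ij) //; apply: leq_trans szh _.
    by rewrite -add1n leq_add2r subn_gt0.
  pose h' := h - h`_n *: 'X^n.
  have szh' : (size h' <= n)%N.
    apply/leq_sizeP => k; rewrite leq_eqVlt coefB coefZ coefXn => /orP[/eqP<-|lt_nk].
      by rewrite eqxx mulr1 subrr.
    rewrite gtn_eqF // mulr0 subr0 nth_default //.
    exact: leq_trans szh _.
  have : coefs_in I (g`_j *: h').
    apply: IHn; first exact: leq_trans (size_scale_leq _ _) szh'.
    rewrite -scalerAr mulrBr scalerBr; apply: coefsB => //.
      exact: coefsZ.
    by rewrite -scalerAr scalerA scalerAr; apply: coefsM => //; apply: coefsZX.
  rewrite /h' scalerBr scalerA => /(coefsD hI)/(_ (coefsZX hI n Ijn)).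
  by rewrite subrK.
move=> i; apply: wI; exists g => // j; rewrite coefZ mulrC -coefZ.
by apply: (gjh (size g)); rewrite leq_addl.
Qed.

Lemma unit_content1 : unit_content 1.
Proof.
split=> [||x]; [|exact: oner_neq0|].
  by rewrite -[1]/(1%:P); apply: (coefsC base_submodule); apply: base1.
by move/(_ 0%N); rewrite alg_polyC coefC.
Qed.

(** A Gauss lemma: if x g h has coefficients in D, [coefs_in_divl] for the w-closed module D cancels
    [g], and then [h] forces x into D. *)
Lemma unit_contentM g h :
  unit_content g -> unit_content h -> unit_content (g * h).
Proof.
move=> ug uh; have [Dg g0 _] := ug; have [Dh h0 hu] := uh.
split=> [||x]; [exact: coefsM base_submodule _ _ _ _ | exact: mulf_neq0 |].
rewrite scalerAr => /(coefs_in_divl base_submodule base_w_closed ug).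
exact: hu.
Qed.

Lemma inv_w_closed (I : set K) : w_closed (inv_ideal I).
Proof.
move=> x [g [_ _ gu] xg] y Iy; apply: gu => i.
by rewrite coefZ mulrAC -coefZ; apply: xg.
Qed.

Lemma sub_w_hull (I : set K) : is_submodule I -> I `<=` w_hull I.
Proof.
move=> hI x Ix; exists 1; first exact: unit_content1.
by rewrite alg_polyC; apply: coefsC.
Qed.

Section WHull.
Variable I : set K.
Hypothesis hI : is_submodule I.

Lemma w_hull_submodule : is_submodule (w_hull I).
Proof.
split=> [|x y [g ug xg] [h uh yh]|a x [g ug xg]].
- by apply: sub_w_hull => //; apply: submodule0.
- exists (g * h); first exact: unit_contentM.
  have [[Dg _ _] [Dh _ _]] := (ug, uh).
  rewrite scalerDl; apply: coefsD => //; last by rewrite scalerAr; apply: coefsM.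
  by rewrite mulrC scalerAr; apply: coefsM.
- by exists g => //; rewrite -scalerA; apply: coefsZ => //; exists a.
Qed.

(** Each coefficient has its own unit content multiplier; the product of these finitely many
    multipliers serves all coefficients at once. *)
Lemma w_hull_coefs h :
  coefs_in (w_hull I) h -> exists2 g, unit_content g & coefs_in I (g * h).
Proof.
elim/poly_ind: h => [|p c IHp] hp.
  by exists 1; [exact: unit_content1 | rewrite mulr0; apply: coefs0].
have [|g ug gp] := IHp.
  by move=> i; have := hp i.+1; rewrite coefD coefMX coefC addr0.
have [g' ug' cg'] : w_hull I c by have := hp 0%N; rewrite coefD coefMX coefC add0r.
have [[Dg _ _] [Dg' _ _]] := (ug, ug').
exists (g * g'); first exact: unit_contentM.
rewrite mulrDr; apply: coefsD => //; last first.
  by rewrite -mulrA; apply: coefsM => //; rewrite mulrC mul_polyC.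
have -> : g * g' * (p * 'X) = 'X * (g' * (g * p)) by ring.
by apply: coefsM => //; [exact: (base_coefsX 1) | exact: coefsM].
Qed.

Lemma w_hull_closed : w_closed (w_hull I).
Proof.
move=> x [g ug /w_hull_coefs[h uh hxg]].
exists (h * g); first exact: unit_contentM.
by rewrite scalerAr.
Qed.

End WHull.

Lemma divisorial_w_closed (I : set K) : divisorial_ideal I -> w_closed I.
Proof. by move=> [_ _ ->]; apply: inv_w_closed. Qed.

(** The w-hull of [I] is a w-ideal, hence divisorial by hypothesis, and a divisorial ideal
    containing [I] contains I_v. *)
Lemma v_closure_w_hull (I : set K) :
  w_divisorial_domain D -> fractional_ideal I -> nonzero_set I ->
  v_closure I `<=` w_hull I.
Proof.
move=> wD [hI [d d0 dI]] [z Iz z0].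
have hw := w_hull_submodule hI.
have [] := wD (w_hull I) => [|_ _ ->].
  split.
  - split=> //; exists d => // x [g [_ _ gu] xg]; apply: gu => i.
    by rewrite coefZ -mulrA -coefZ; apply: dI.
  - by exists z => //; apply: sub_w_hull.
  - rewrite w_closureE //; apply/seteqP; split; first exact: sub_w_hull.
    exact: w_hull_closed.
by apply: v_closure_mono; apply: sub_w_hull.
Qed.

(** * Quotients that are simple up to the w-operation *)

Definition adjoin (I : set K) (y : K) : set K :=
  [set z | exists2 m, I m & exists2 b, base_domain b & z = m + b * y].

Definition conductor (I : set K) (y : K) : set K :=
  [set m | base_domain m /\ I (m * y)].

(* The quotient of [J] by [I] is simple up to the w-operation. *)
Definition w_simple (I J : set K) : Prop :=
  forall y, J y -> ~ I y -> J `<=` w_hull (adjoin I y).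

Section Adjoin.
Variables (I : set K) (y : K).
Hypothesis hI : is_submodule I.

Lemma adjoin_submodule : is_submodule (adjoin I y).
Proof.
split=> [|_ _ [m Im [b Db ->]] [n In [c Dc ->]]|a _ [m Im [b Db ->]]].
- by exists 0; [exact: submodule0 | exists 0; [exact: base0 | rewrite mul0r addr0]].
- exists (m + n); first exact: submoduleD.
  by exists (b + c); [exact: baseD | rewrite mulrDl addrACA].
- exists (tofrac a * m); first by apply: submoduleM => //; exists a.
  exists (tofrac a * b); first by apply: baseM => //; exists a.
  by rewrite mulrDr mulrA.
Qed.

Lemma sub_adjoin : I `<=` adjoin I y.
Proof.
by move=> m Im; exists m => //; exists 0; [exact: base0 | rewrite mul0r addr0].
Qed.

Lemma mem_adjoin : adjoin I y y.
Proof.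
by exists 0; [exact: submodule0 | exists 1; [exact: base1 | rewrite mul1r add0r]].
Qed.

Lemma coefs_in_adjoin h : coefs_in (adjoin I y) h ->
  exists2 s, coefs_in (@base_domain D) s & coefs_in I (h - y *: s).
Proof.
move=> hh.
have /choice[b hb] : forall i, exists b, base_domain b /\ I (h`_i - b * y).
  by move=> i; have [m Im [b Db ->]] := hh i; exists b; rewrite addrK.
exists (\poly_(i < size h) b i) => i; rewrite ?(coefB, coefZ) coef_poly.
  by case: ifP => _; [case: (hb i) | exact: base0].
case: ltnP => [_|szi]; first by rewrite mulrC; case: (hb i).
by rewrite mulr0 subr0 nth_default //; apply: submodule0.
Qed.

Lemma conductor_submodule : is_submodule (conductor I y).
Proof.
split=> [|a b [Da Ia] [Db Ib]|a x [Dx Ix]].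
- by split; [exact: base0 | rewrite mul0r; apply: submodule0].
- by split; [exact: baseD | rewrite mulrDl; apply: submoduleD].
- by split; [apply: baseM | rewrite -mulrA; apply: submoduleM] => //; exists a.
Qed.

(** Multiplication by [y] embeds D/M into J/I, where M = (I : y): for z outside M, z y lies outside
    [I], so [y] is in the w-hull of I + D z y, and [y] can be cancelled. *)
Lemma w_simple_conductor (J : set K) : is_submodule J ->
  w_simple I J -> J y -> ~ I y -> w_simple (conductor I y) (@base_domain D).
Proof.
move=> hJ sIJ Jy Iy z Dz Mz x Dx.
have [||g ug yg] := sIJ (z * y) _ _ y Jy; first exact: submoduleM.
  by move=> Izy; apply: Mz.
exists g => // i; have := yg i; rewrite !coefZ => -[m Im [b Db ygE]].
have [Dg _ _] := ug.
exists (x * (g`_i - b * z)).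
  split; first apply: baseM => //.
    by apply: (submoduleB base_submodule) => //; apply: baseM.
  by rewrite -mulrA; apply: submoduleM => //; rewrite mulrBl mulrC ygE mulrA addrK.
by exists (x * b); [exact: baseM | rewrite mulrBr mulrA subrK].
Qed.

End Adjoin.

(** For y in M^-1 outside D, (D + Dy)^-1 lies in M: an element z of it outside M would put 1 in the
    w-hull of M + Dz, and [y] multiplies both M and z into D. Taking inverses, M^-1 lies in (D +
    Dy)_v, which is within the w-hull. *)
Lemma w_simple_inv (M : set K) : w_divisorial_domain D ->
  w_simple M (@base_domain D) -> w_simple (@base_domain D) (inv_ideal M).
Proof.
move=> wD sM y My Dy x Mx; apply: v_closure_w_hull => //.
- split; first exact: adjoin_submodule base_submodule.
  have [n [d [d0 ->]]] := fractionP y; exists d => // _ [m Dm [b Db ->]].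
  rewrite mulrDr mulrCA [_ * (_ / _)]mulrC divfK ?tofrac_eq0 //.
  by apply: baseD; apply: baseM => //; [exists d | exists n].
- by exists 1; rewrite ?oner_neq0 //; apply: sub_adjoin; apply: base1.
move=> z zA; apply: Mx; apply: contrapT => Mz; apply: Dy.
have Dz : base_domain z.
  by rewrite -[z]mulr1; apply: zA; apply: sub_adjoin; apply: base1.
have [g [_ _ gu] g1] := sM z Dz Mz 1 base1.
apply: gu => i; have [m Mm [b Db]] := g1 i.
rewrite !coefZ mul1r => ->; rewrite mulrDr; apply: baseD; first exact: My.
rewrite mulrCA; apply: baseM => //; rewrite mulrC.
by apply: zA; apply: mem_adjoin base_submodule.
Qed.

(* If [y] is a coefficient of [u] outside [I] and [M = (I : y)], then
   [g1 * u = y *: s1] modulo [I[X]] with [s1] outside [M[X]]; since [M] is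
   w-maximal, [s1] is congruent modulo [M[X]] to a unit content polynomial [t]. *)
Lemma w_simple_division (I J : set K) u x :
  is_submodule I -> is_submodule J -> w_closed I -> w_simple I J ->
  coefs_in J u -> ~ coefs_in I u -> coefs_in J x ->
  exists2 g, unit_content g &
    exists2 s, coefs_in (@base_domain D) s & coefs_in I (g * x - s * u).
Proof.
move=> hI hJ wI sIJ Ju Iu Jx.
have [k Iy] : exists k, ~ I u`_k by apply/existsNP.
set y := u`_k in Iy; have Jy : J y by apply: Ju.
have divy p : coefs_in J p -> exists2 g, unit_content g &
    exists2 s, coefs_in (@base_domain D) s & coefs_in I (g * p - y *: s).
  move=> Jp; have [i|g ug gp] := w_hull_coefs (adjoin_submodule y hI) (h := p).
    exact: sIJ.
  by exists g => //; apply: coefs_in_adjoin.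
have [g1 ug1 [s1 Ds1 Is1]] := divy u Ju.
have [g2 ug2 [s2 Ds2 Is2]] := divy x Jx.
pose M := conductor I y; have hM : is_submodule M := conductor_submodule y hI.
have yM p : coefs_in M p -> coefs_in I (y *: p).
  by move=> Mp i; rewrite coefZ mulrC; case: (Mp i).
have [l Ml] : exists l, ~ M s1`_l.
  apply/existsNP => Ms1; apply: Iu; apply: (coefs_in_divl hI wI ug1).
  by rewrite -[_ * _](subrK (y *: s1)); apply: coefsD => //; apply: yM.
have sM : w_simple M (@base_domain D) by apply: w_simple_conductor sIJ Jy Iy.
have [f [_ _ fu] f1] := sM _ (Ds1 l) Ml 1 base1.
have [e De Me] := coefs_in_adjoin hM f1; rewrite scale1r in Me.
(* The shift by [size s1] prevents overlap: if z t has coefficients in D, so have z s1 and z (f -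
   s1_l e), hence also z f, and z is in D. *)
pose m := (f - s1`_l *: e) * 'X^(size s1); pose t := s1 + m.
have Mm : coefs_in M m by rewrite /m mulrC; apply: coefsM => //; apply: base_coefsX.
have tE i : (i < size s1)%N -> t`_i = s1`_i.
  by move=> lti; rewrite coefD coefMXn lti addr0.
have lt_l : (l < size s1)%N.
  rewrite ltnNge; apply/negP => /leq_sizeP s0; apply: Ml.
  by rewrite s0 //; apply: submodule0.
have ut : unit_content t.
  split=> [||z zt].
  - by apply: (coefsD base_submodule) => // i; case: (Mm i).
  - apply/eqP => t0; apply: Ml; rewrite -tE // t0 coef0; exact: submodule0.
  - apply: fu => i; have := zt (i + size s1)%N.
    have := zt l; rewrite !coefZ tE // => Dzl.
    rewrite coefD [s1`__]nth_default ?leq_addl // add0r coefMXn.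
    rewrite ltnNge leq_addl addnK coefB coefZ mulrBr mulrA => Dzf.
    rewrite -[_ * _](subrK (z * s1`_l * e`_i)); apply: baseD => //.
    exact: baseM.
have [Dt _ _] := ut; have [Dg1 _ _] := ug1.
exists (t * g2); first exact: unit_contentM.
exists (s2 * g1); first exact: (coefsM base_submodule).
(* Modulo I[X], g1 u = y t and g2 x = y s2; this eliminates [y]. *)
have -> : t * g2 * x - s2 * g1 * u =
    t * (g2 * x - y *: s2) + s2 * (y *: m - (g1 * u - y *: s1)).
  by rewrite /t -!mul_polyC; ring.
apply: coefsD => //; first exact: coefsM.
by apply: coefsM => //; apply: coefsB => //; apply: yM.
Qed.

(** * Ideals of D[X] containing a nonzero constant *)

Lemma integral_fractional (I : set K) : integral_ideal I -> fractional_ideal I.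
Proof.
move=> [hI ID]; split=> //; exists 1; rewrite ?oner_neq0 // => x /ID.
by rewrite tofrac1 mul1r.
Qed.

Lemma inv_divisorial (I : set K) :
  inv_ideal I `<=` @base_domain D -> nonzero_set (inv_ideal I) ->
  integral_ideal (inv_ideal I) /\ divisorial_ideal (inv_ideal I).
Proof.
move=> ID I0; have hI : integral_ideal (inv_ideal I).
  by split=> //; apply: inv_submodule.
split=> //; split=> //; first exact: integral_fractional.
by rewrite -[LHS]inv_v_closure.
Qed.

(** * Maximal and minimal divisorial ideals *)

Lemma mori_max (P : set (set K)) : mori_domain D ->
  (forall I, P I -> integral_ideal I /\ divisorial_ideal I) ->
  (exists I, P I) -> exists2 I, P I & forall J, P J -> I `<=` J -> J = I.
Proof.
move=> mD hP [I0 PI0]; apply: contrapT => nomax.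
have /choice[f fP] : forall I : {I | P I}, exists J : {I | P I},
    sval I `<=` sval J /\ sval J <> sval I.
  move=> [I PI]; apply: contrapT => noJ; apply: nomax; exists I => // J PJ sIJ.
  by apply: contrapT => neq; apply: noJ; exists (exist _ J PJ).
pose u n := iter n f (exist _ I0 PI0).
have [||N uN] := mD (fun n => sval (u n)).
- by move=> n; apply: hP; apply: svalP.
- by move=> n; case: (fP (u n)).
by case: (fP (u N)) => _; apply; apply: (uN N.+1).
Qed.

(* Descending chains above a nonzero [a] are turned into ascending ones by the
   duality [I |-> a I^-1]. *)
Lemma mori_min (P : set (set K)) (a : K) : mori_domain D -> a != 0 ->
  (forall I, P I -> [/\ integral_ideal I, divisorial_ideal I & I a]) ->
  (exists I, P I) -> exists2 I, P I & forall J, P J -> J `<=` I -> J = I.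
Proof.
move=> mD a0 hP [I0 PI0].
pose dual (I : set K) := inv_ideal [set z | I (a * z)].
have [||_ [I PI ->] maxI] := @mori_max [set J | exists2 I, P I & J = dual I] mD.
- move=> _ [I PI ->]; have [[_ ID] _ Ia] := hP I PI.
  apply: inv_divisorial => [x xI|].
    by rewrite -[x]mulr1; apply: xI; rewrite /= mulr1.
  by exists a => // z /ID.
- by exists (dual I0); exists I0.
exists I => // J PJ sJI; have [_ [_ _ ->] _] := hP J PJ.
apply/seteqP; split; first by have [_ [_ _ ->] _] := hP I PI; apply: v_closure_mono.
move=> x Ix y Jy.
have : dual J (a * y) by move=> z /Jy; rewrite mulrA [y * a]mulrC.
rewrite (maxI (dual J)); last 2 first.
- by exists J.
- by apply: inv_ideal_anti => z; apply: sJI.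
move/(_ (a^-1 * x)); rewrite /= mulVKf // => /(_ Ix).
by rewrite mulrACA divff // mul1r mulrC.
Qed.

Definition poly_submodule (T : set {poly K}) : Prop :=
  (forall p q, T p -> T q -> T (p + q)) /\
  (forall c p, coefs_in (@base_domain D) c -> T p -> T (c * p)).

Definition content_saturated (T : set {poly K}) : Prop :=
  forall g h, unit_content g -> T (g * h) -> T h.

(** When [T] contains a nonzero constant, this is the whole inverse of [T] in K(X), since anything
    multiplying that constant into D[X] lies in K[X]. *)
Definition poly_dual (T : set {poly K}) : set {poly K} :=
  [set p | forall t, T t -> coefs_in (@base_domain D) (p * t)].

Definition poly_divisorial_below (a : K) (I : set K) : Prop :=
  forall T, poly_submodule T -> content_saturated T -> T a%:P ->
    T `<=` coefs_in I -> poly_dual (poly_dual T) `<=` T.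

(** Here [I] lies in aD, so a^-1 is in the dual of [T]; any x in the double dual is then the
    multiple (x a^-1) a of an element of [T]. *)
Lemma poly_divisorial_principal (a : K) (I : set K) : a != 0 ->
  (forall x, I x -> base_domain (a^-1 * x)) -> poly_divisorial_below a I.
Proof.
move=> a0 Ia T [_ hT] _ Ta TI x xT.
have -> : x = (x * (a^-1)%:P) * a%:P.
  by rewrite -mulrA -polyCM mulVf // mulr1.
apply: hT => //; apply: xT => t /TI It i.
by rewrite mul_polyC coefZ; apply: Ia.
Qed.

(* Take [u] in [T] outside [I[X]]; modulo unit content polynomials [T] is
   generated by [u] and [T1 = T cap I[X]], so it is enough to treat [y] in
   [T_vv cap I[X]] and show that [y] lies in [(T1)_vv].  For [p] in the dual of
   [T1] and [r] in [I^-1 \ J^-1], both [p * u] and [r *: u] have coefficients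
   in [M^-1], with [r *: u] outside [D[X]], and [M^-1 / D] is w-simple:
   correcting a multiple of [p] by a multiple of [r] gives an element of the
   dual of [T]. *)
Lemma poly_divisorial_step (a : K) (I J : set K) : w_divisorial_domain D ->
  divisorial_ideal I -> divisorial_ideal J -> I `<=` J -> I != J ->
  w_simple I J -> I a ->
  poly_divisorial_below a I -> poly_divisorial_below a J.
Proof.
move=> wD dI dJ sIJ neIJ sim Ia divI T [TD TM] satT Ta TJ x xT.
have [[hI _] _ Iv] := dI; have [[hJ _] _ Jv] := dJ.
have wI := divisorial_w_closed dI.
have hB := base_submodule; have wB := base_w_closed.
have TB p q : T p -> T q -> T (p - q).
  move=> Tp Tq; apply: TD => //; rewrite -mulN1r; apply: TM => //.
  by rewrite -polyC1 -polyCN; apply: coefsC => //; apply: (submoduleN hB base1).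
have [TI|/existsNP[u /not_implyP[Tu Iu]]] := pselect (T `<=` coefs_in I).
  exact: divI TI x xT.
have Ju := TJ u Tu.
have divu p : coefs_in J p -> exists2 g, unit_content g &
    exists2 s, coefs_in (@base_domain D) s & coefs_in I (g * p - s * u).
  exact: w_simple_division.
(* Constants from J^-1 lie in the dual of [T], so the coefficients of [x] lie in J_v = J. *)
have Jx : coefs_in J x.
  move=> i; rewrite Jv => s Js; rewrite mulrC -coefZ -mul_polyC mulrC.
  apply: xT => t /TJ Jt k; rewrite mul_polyC coefZ; exact: Js.
have [g ug [s Ds]] := divu x Jx.
set y := g * x - s * u => Iy.
have [Dg _ _] := ug.
pose T1 : set {poly K} := [set t | T t /\ coefs_in I t].
suff T1y : poly_dual (poly_dual T1) y.
  have [] : T1 y; last first.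
    move=> Ty _; apply: (satT _ _ ug); rewrite -[_ * _](subrK (s * u)).
    by apply: TD => //; apply: TM.
  apply: divI T1y; first 1 last.
  - by move=> g1 h ug1 [/satT Th /(coefs_in_divl hI wI ug1) Ih]; split=> //; apply: Th.
  - by split=> //; apply: coefsC.
  - by move=> t [].
  split=> [p q [Tp Ip] [Tq Iq]|c p Dc [Tp Ip]]; split.
  - exact: TD.
  - exact: coefsD.
  - exact: TM.
  - exact: coefsM.
move=> p pT1; rewrite mulrC.
have [k Ik] : exists k, ~ I u`_k by apply/existsNP.
pose M := conductor I u`_k.
(* M J is contained in [I], because [J] lies in the w-hull of I + D u_k and [M] multiplies this sum
   into [I]. *)
have MJ m z : M m -> J z -> I (m * z).
  move=> [Dm Im] Jz; apply: wI; have [e ue ze] := sim _ (Ju k) Ik z Jz.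
  exists e => // i; have [De _ _] := ue.
  have := ze i; rewrite !coefZ => -[n In [b Db ez]].
  rewrite -mulrA ez mulrDr; apply: submoduleD => //; first exact: submoduleM.
  by rewrite mulrCA; apply: submoduleM.
have MpuP m i : M m -> base_domain ((p * u)`_i * m).
  move=> Mm; rewrite mulrC -coefZ -mul_polyC mulrCA mul_polyC; apply: pT1.
  split; first by rewrite -mul_polyC; apply: TM => //; apply: coefsC => //; case: Mm.
  by move=> j; rewrite coefZ; apply: MJ.
have [r Ir Jr] : exists2 r, inv_ideal I r & ~ inv_ideal J r.
  apply: contrapT => nor; case/eqP: neIJ; apply/seteqP; split=> // z.
  rewrite Jv Iv; apply: inv_ideal_anti => r Ir.
  by apply: contrapT => Jr; apply: nor; exists r.
have rI w : coefs_in I w -> coefs_in (@base_domain D) (r *: w).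
  by move=> Iw i; rewrite coefZ; apply: Ir.
have ru_M : coefs_in (inv_ideal M) (r *: u).
  by move=> i m Mm; rewrite coefZ -mulrA [_ * m]mulrC; apply: Ir; apply: MJ.
(* Up to unit content, every z in [J] is a multiple of [u] modulo I[X]; so r u in D[X] would give r
   J in D. *)
have ru_D : ~ coefs_in (@base_domain D) (r *: u).
  move=> Dru; apply: Jr => z Jz.
  have [|g1 [Dg1 _ g1u] [s1 Ds1 Iz]] := divu z%:P; first exact: coefsC.
  apply: g1u; rewrite -mul_polyC polyCM mulrC.
  have -> : g1 * (r%:P * z%:P) = r%:P * (g1 * z%:P - s1 * u) + s1 * (r%:P * u).
    by ring.
  rewrite !mul_polyC; apply: coefsD => //; first exact: rI.
  exact: coefsM.
have simD := w_simple_inv wD (w_simple_conductor hI hJ sim (Ju k) Ik).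
have [|e ue [c Dc]] := w_simple_division hB (inv_submodule M) wB simD ru_M ru_D
  (x := p * u); first by move=> i m; apply: MpuP.
move=> Dqu.
(* [q] multiplies into D[X] both T1, because [p] and [r] do, and [u], by the choice of [c]; hence it
   lies in the dual of [T]. *)
pose q := e * p - r *: c.
have qu : coefs_in (@base_domain D) (q * u).
  suff -> : q * u = e * (p * u) - c * (r *: u) by [].
  by rewrite /q -!mul_polyC; ring.
have [De _ _] := ue.
have qT t : T t -> coefs_in (@base_domain D) (q * t).
  move=> Tt; have [g1 ug1 [s1 Ds1 It]] := divu t (TJ t Tt).
  apply: (coefs_in_divl hB wB ug1).
  set w := g1 * t - s1 * u in It.
  have -> : g1 * (q * t) = (e * (p * w) - c * (r *: w)) + s1 * (q * u).
    by rewrite /q /w -!mul_polyC; ring.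
  have [Dg1 _ _] := ug1.
  apply: coefsD => //; last exact: coefsM.
  apply: coefsB => //; apply: coefsM => //; last exact: rI.
  by apply: pT1; split=> //; apply: TB; apply: TM.
apply: (coefs_in_divl hB wB ue).
have -> : e * (p * y) = (g * (x * q) - s * (q * u)) + c * (r *: y).
  by rewrite /q /y -!mul_polyC; ring.
apply: coefsD => //; last by apply: coefsM => //; apply: rI.
apply: coefsB => //; apply: coefsM => //.
exact: xT.
Qed.

(** Take a minimal counterexample [I] among the divisorial ideals containing [a]. It is not inside
    aD, so some divisorial [J] is maximal with a in J < I; by minimality [J] is no counterexample,
    and the step from [J] to [I] applies. *)
Lemma base_poly_divisorial (a : K) : mori_domain D -> w_divisorial_domain D ->
  base_domain a -> a != 0 -> poly_divisorial_below a (@base_domain D).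
Proof.
move=> mD wD Da a0; apply: contrapT => ndiv.
have [||I [[hI dI Ia] nI] minI] := @mori_min [set I |
  [/\ integral_ideal I, divisorial_ideal I & I a] /\ ~ poly_divisorial_below a I]
  a mD a0.
- by move=> I [].
- exists (@base_domain D); split=> //.
  have := @inv_divisorial (@base_domain D); rewrite inv_base => -[] //.
  by exists 1; [exact: base1 | exact: oner_neq0].
have [[smI ID] [_ _ Iv]] := (hI, dI).
have /existsNP[z /not_implyP[Iz az]] : ~ forall x, I x -> base_domain (a^-1 * x).
  by move=> aI; apply: nI; apply: poly_divisorial_principal.
pose lower (J : set K) := [/\ integral_ideal J, divisorial_ideal J, J a & J `<`  I].
have [||J [hJ dJ Ja [sJI nIJ]] maxJ] := @mori_max lower mD.
- by move=> J [].
- pose aD : set K := inv_ideal [set a^-1].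
  have aDE x : aD x <-> base_domain (a^-1 * x).
    by rewrite mulrC; split=> [|aDx _ ->] //; apply.
  have aDI : aD `<=` I.
    by move=> x /aDE /(submoduleMr smI)/(_ Ia); rewrite mulVKf.
  have aDa : aD a by apply/aDE; rewrite mulVf //; apply: base1.
  exists aD; have [||hA dA] := @inv_divisorial [set a^-1].
  + by move=> x /aDI /ID.
  + by exists a.
  + by split=> //; split=> // sIA; apply: az; apply/aDE; apply: sIA.
apply: nI; apply: (poly_divisorial_step wD dJ dI sJI) => //.
- by apply/eqP => eqJI; apply: nIJ; rewrite eqJI.
- move=> y Iy Jy; set A := adjoin J y.
  have hA : is_submodule A by apply: adjoin_submodule; case: hJ.
  have AI : A `<=` I.
    move=> _ [m Jm [b Db ->]].
    by apply: submoduleD => //; [apply: sJI | apply: submoduleM].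
  have VI : v_closure A `<=` I by rewrite Iv; apply: v_closure_mono.
  have JA : J `<=` A by apply: sub_adjoin.
  have [z0 Jz0 z00] : nonzero_set J by case: dJ.
  (* By maximality of [J], a v-closure strictly between [J] and [I] is impossible, so (J + Dy)_v is
     all of [I]. *)
  apply: (@subset_trans _ (v_closure A)); last first.
    apply: v_closure_w_hull => //; last by exists z0 => //; apply: JA.
    by apply: integral_fractional; split=> // x /AI /ID.
  apply: contrapT => IV; apply: Jy.
  rewrite -(maxJ (v_closure A)).
  + by apply: sub_v_closure; apply: mem_adjoin; case: hJ.
  + have [||hV dV] := @inv_divisorial (inv_ideal A).
    * by move=> x /VI /ID.
    * by exists z0 => //; apply/sub_v_closure/JA.
    by split=> //; apply/sub_v_closure/JA.
  + by move=> x /JA; apply: sub_v_closure.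
- apply: contrapT => nJ; apply: nIJ.
  by rewrite (minI J) //; split.
Qed.

(** * Uniform denominators *)

Lemma size_le_pred (R : nzRingType) (p : {poly R}) k :
  (size p <= k.+1)%N -> p`_k = 0 -> (size p <= k)%N.
Proof.
move=> szp pk; apply/leq_sizeP => j; rewrite leq_eqVlt => /orP[/eqP<- //|ltkj].
by rewrite nth_default // (leq_trans szp).
Qed.

(* The leading coefficients of the elements of [f K[X] cap D[X]] of degree at
   most [j] form an ascending chain of ideals, stationary up to the w-closure;
   this reduces the degree of [f * h] down to the stabilization index, below
   which powers of the leading coefficient of [f] suffice. *)
Lemma bounded_denominators f : mori_domain D -> w_divisorial_domain D ->
  coefs_in (@base_domain D) f -> f != 0 ->
  exists2 d, base_domain d /\ d != 0 &
    forall h, coefs_in (@base_domain D) (f * h) ->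
              coefs_in (@base_domain D) (d *: h).
Proof.
move=> mD wD Df f0; have hB := base_submodule.
pose L j : set K := [set x | exists h, [/\ coefs_in (@base_domain D) (f * h),
  (size (f * h)%R <= j.+1)%N & x = (f * h)`_j]].
have hL j : is_submodule (L j).
  split=> [|_ _ [p [Dp sp ->]] [q [Dq sq ->]]|a _ [p [Dp sp ->]]].
  - by exists 0; rewrite mulr0 size_poly0 coef0; split=> //; apply: coefs0.
  - exists (p + q); rewrite mulrDr; split; [exact: coefsD | | by rewrite coefD].
    by apply: leq_trans (size_polyD _ _) _; rewrite geq_max sp.
  - exists (tofrac a *: p); rewrite -scalerAr; split; last by rewrite coefZ.
      by apply: coefsZ => //; exists a.
    exact: leq_trans (size_scale_leq _ _) sp.
have sL j : L j `<=` L j.+1.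
  move=> _ [p [Dp sp ->]]; exists (p * 'X); rewrite mulrA; split.
  - by rewrite mulrC; apply: coefsM => //; apply: (base_coefsX 1).
  - by apply: leq_trans (size_polyMleq _ _) _; rewrite size_polyX addn2 /= ltnS.
  - by rewrite coefMX.
have LD j : L j `<=` @base_domain D by move=> _ [p [Dp _ ->]].
have L0 i : nonzero_set (L ((size f).-1 + i)%N).
  exists (lead_coef f); rewrite ?lead_coef_eq0 //; exists 'X^i; split.
  - by rewrite mulrC; apply: coefsM => //; apply: base_coefsX.
  - by rewrite size_mulXn // addnC -addSn prednK // size_poly_gt0.
  - by rewrite coefMXn ltnNge leq_addl addnK.
(* The chain starts at index deg f, from which on the ideals [L j] are nonzero and their v-closures
   divisorial. *)
have [||N stab] := mD (fun i => v_closure (L ((size f).-1 + i)%N)).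
- move=> i; have [x Lx x0] := L0 i.
  have [||//] := @inv_divisorial (inv_ideal (L ((size f).-1 + i)%N)).
    by move=> z /(v_closure_mono (@LD _)); rewrite /v_closure !inv_base.
  by exists x => //; apply: sub_v_closure.
- by move=> i; rewrite addnS; apply: v_closure_mono; apply: sL.
pose n := ((size f).-1 + N)%N.
have Ln j : (n <= j)%N -> L j `<=` w_hull (L n).
  move=> le_nj x Lx; apply: v_closure_w_hull => //.
  - by apply: integral_fractional; split.
  - exact: L0.
  have le_N : (N <= j - (size f).-1)%N.
    by rewrite leq_subRL //; apply: leq_trans le_nj; apply: leq_addr.
  rewrite /n -(stab _ le_N) subnKC; first exact: sub_v_closure.
  by apply: leq_trans le_nj; apply: leq_addr.
pose a := lead_coef f; have Da : base_domain a by apply: Df.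
have a0 : a != 0 by rewrite lead_coef_eq0.
have Dak k : base_domain (a ^+ k).
  by elim: k => [|k IHk]; rewrite ?expr0 ?exprS; [exact: base1 | exact: baseM].
(* Each factor [a] clears one more coefficient: the leading coefficient of f h is a h_k, so the top
   term of a h is over D and can be split off. *)
have small k (h : {poly K}) : (size h <= k)%N -> coefs_in (@base_domain D) (f * h) ->
    coefs_in (@base_domain D) (a ^+ k *: h).
  elim: k h => [|k IHk] h.
    by rewrite leqn0 size_poly_eq0 => /eqP-> _; rewrite scaler0; apply: coefs0.
  move=> szh Dfh.
  move: szh; rewrite leq_eqVlt ltnS => /orP[/eqP szh|szh]; last first.
    by rewrite exprS -scalerA; apply: coefsZ => //; apply: IHk.
  have Dah : base_domain (a * h`_k).
    by rewrite -[k]/(k.+1.-1) -szh -lead_coefM; apply: Dfh.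
  pose h' := a *: h - (a * h`_k) *: 'X^k.
  rewrite exprSr -scalerA -[a *: h](subrK ((a * h`_k) *: 'X^k)) scalerDr.
  apply: coefsD => //; last by apply: coefsZ => //; apply: coefsZX.
  apply: (IHk h'); last first.
    rewrite /h' mulrBr -scalerAr; apply: coefsB => //; first exact: coefsZ.
    by apply: coefsM => //; apply: coefsZX.
  apply: size_le_pred; last by rewrite coefB !coefZ coefXn eqxx mulr1 subrr.
  apply: leq_trans (size_polyD _ _) _; rewrite geq_max size_polyN.
  rewrite -{1}szh size_scale_leq.
  by apply: leq_trans (size_scale_leq _ _) _; rewrite size_polyXn.
have sz_h (h : {poly K}) : (size h <= size (f * h)%R)%N.
  have [->|h0] := eqVneq h 0; first by rewrite size_poly0.
  by rewrite size_mul // -subn1 -addnBAC ?size_poly_gt0 // leq_addl.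
exists (a ^+ n.+1); first by rewrite expf_neq0.
have main k : forall h : {poly K}, (size (f * h)%R <= k)%N ->
    coefs_in (@base_domain D) (f * h) -> coefs_in (@base_domain D) (a ^+ n.+1 *: h).
  elim: k => [|k IHk] h szh Dfh.
    by apply: small => //; apply: leq_trans (sz_h h) (leq_trans szh _).
  have [le_kn|lt_nk] := leqP k n.
    by apply: small => //; apply: leq_trans (sz_h h) (leq_trans szh _).
  have [|g [Dg _ gu] lg] := Ln k (ltnW lt_nk) (f * h)`_k; first by exists h.
  (* The leading coefficient of f h times g_i is the degree n coefficient of some f h0; subtracting
     f h0 X^(k-n) from g_i f h lowers the size, and h0 has size at most n + 1. *)
  suff gh i : coefs_in (@base_domain D) (g`_i *: (a ^+ n.+1 *: h)).
    by move=> j; apply: gu => i; rewrite coefZ mulrC -coefZ; apply: gh.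
  have [h0 [Dfh0 szh0 lgi]] := lg i.
  have -> : g`_i *: (a ^+ n.+1 *: h) =
      a ^+ n.+1 *: (g`_i *: h - h0 * 'X^(k - n)) + a ^+ n.+1 *: h0 * 'X^(k - n).
    by rewrite -!mul_polyC; ring.
  have Dh0 : coefs_in (@base_domain D) (a ^+ n.+1 *: h0).
    by apply: small => //; apply: leq_trans (sz_h h0) szh0.
  apply: coefsD => //; last by rewrite mulrC; apply: coefsM => //; apply: base_coefsX.
  have fE : f * (g`_i *: h - h0 * 'X^(k - n)) =
      g`_i *: (f * h) - (f * h0) * 'X^(k - n) by rewrite -!mul_polyC; ring.
  apply: IHk; rewrite fE; last first.
    apply: coefsB => //; first exact: coefsZ.
    by rewrite mulrC; apply: coefsM => //; apply: base_coefsX.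
  apply: size_le_pred; last first.
    rewrite coefB coefZ coefMXn ltnNge leq_subr subKn ?(ltnW lt_nk) //=.
    by rewrite -lgi coefZ mulrC subrr.
  apply: leq_trans (size_polyD _ _) _; rewrite geq_max size_polyN.
  rewrite (leq_trans (size_scale_leq _ _) szh) /=.
  apply: leq_trans (size_polyMleq _ _) _; rewrite size_polyXn addnS /=.
  by rewrite -(subnKC (ltnW lt_nk)) -addSn addKn leq_add2r.
by move=> h; apply: main (leqnn _).
Qed.

(* The content of [F] is the sum of the contents of the members of [s]. *)
Lemma join_content (s : seq {poly K}) : exists F : {poly K},
  (forall J : set K, J 0 ->
     coefs_in J F <-> (forall g, g \in s -> coefs_in J g)) /\
  (forall I h, is_submodule I ->
     (forall g, g \in s -> coefs_in I (g * h)) -> coefs_in I (F * h)).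
Proof.
elim: s => [|g s [F [FJ Fh]]].
  exists 0; split=> [J J0|I h hI _]; last by rewrite mul0r; apply: coefs0.
  by split=> // _ i; rewrite coef0.
(* The shift places the coefficients of [g] and [F] side by side, so none are added together. *)
exists (g + F * 'X^(size g)); split=> [J J0|I h hI gsI]; last first.
  rewrite mulrDl; apply: coefsD => //; first by apply: gsI; rewrite mem_head.
  rewrite mulrAC mulrC; apply: coefsM => //; first exact: base_coefsX.
  by apply: Fh => // g' sg'; apply: gsI; rewrite inE sg' orbT.
split=> [JgF g'|Jgs i]; last first.
  rewrite coefD coefMXn; case: ltnP => szi.
    by rewrite addr0; apply: Jgs; rewrite mem_head.
  rewrite nth_default // add0r; apply: (proj2 (FJ J J0)) => g' sg'.
  by apply: Jgs; rewrite inE sg' orbT.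
rewrite inE => /orP[/eqP-> i|].
  have [lti|] := ltnP i (size g); last by move=> ?; rewrite nth_default.
  by have := JgF i; rewrite coefD coefMXn lti addr0.
apply: (proj1 (FJ J J0)) => i; have := JgF (i + size g)%N.
by rewrite coefD coefMXn ltnNge leq_addl addnK nth_default ?leq_addl // add0r.
Qed.

End QuotientField.

(** * Transfer to the quotient field of D[X] *)

Section PolynomialRing.
Variable D : idomainType.
Local Notation K := {fraction D}.
Local Notation L := {fraction {poly D}}.

Definition const_frac (x : K) : L :=
  tofrac (\n_(repr x))%:P / tofrac (\d_(repr x))%:P.

Lemma tofracC_neq0 (d : D) : d != 0 -> tofrac d%:P != 0 :> L.
Proof. by rewrite tofrac_eq0 polyC_eq0. Qed.

Lemma const_fracE (n d : D) : d != 0 ->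
  const_frac (tofrac n / tofrac d) = tofrac n%:P / tofrac d%:P.
Proof.
move=> d0; set x := _ / _; rewrite /const_frac.
have := fraction_repr x; rewrite {1}/x; move: (repr x) => r.
have r0 := denom_ratioP r.
move/eqP; rewrite eqr_div ?tofrac_eq0 // -!tofracM tofrac_eq => /eqP nd.
by apply/eqP; rewrite eqr_div ?tofracC_neq0 // -!tofracM -!polyCM nd mulrC.
Qed.

Lemma const_frac_tofrac (a : D) : const_frac (tofrac a) = tofrac a%:P.
Proof.
by rewrite -[tofrac a]divr1 -tofrac1 const_fracE ?oner_neq0 // polyC1 tofrac1 divr1.
Qed.

Lemma const_frac_zmod_morphism : zmod_morphism const_frac.
Proof.
move=> x y; have [n [d [d0 ->]]] := fractionP x; have [m [e [e0 ->]]] := fractionP y.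
rewrite -mulNr addf_div ?tofrac_eq0 // mulNr -!tofracM -tofracB !const_fracE ?mulf_neq0 //.
rewrite -[in RHS]mulNr addf_div ?tofracC_neq0 // mulNr -!tofracM -tofracB.
by rewrite !polyCM polyCB !polyCM.
Qed.

Lemma const_frac_monoid_morphism : monoid_morphism const_frac.
Proof.
split=> [|x y]; first by rewrite -tofrac1 const_frac_tofrac polyC1 tofrac1.
have [n [d [d0 ->]]] := fractionP x; have [m [e [e0 ->]]] := fractionP y.
rewrite mulf_div -!tofracM !const_fracE ?mulf_neq0 //.
by rewrite mulf_div -!tofracM !polyCM.
Qed.

HB.instance Definition _ :=
  GRing.isZmodMorphism.Build K L const_frac const_frac_zmod_morphism.
HB.instance Definition _ :=
  GRing.isMonoidMorphism.Build K L const_frac const_frac_monoid_morphism.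

(** The inclusion of K[X] in K(X). *)
Definition poly_frac : {poly K} -> L :=
  horner_eval (tofrac 'X) \o map_poly const_frac.

HB.instance Definition _ := GRing.RMorphism.on poly_frac.

Lemma poly_fracC c : poly_frac c%:P = const_frac c.
Proof. by rewrite /poly_frac /= /horner_eval map_polyC hornerC. Qed.

Lemma poly_frac_tofrac (p : {poly D}) :
  poly_frac (map_poly (@tofrac D) p) = tofrac p.
Proof.
rewrite /poly_frac /= /horner_eval -map_poly_comp.
have -> : map_poly (const_frac \o @tofrac D) p =
          map_poly (@tofrac {poly D}) (map_poly polyC p).
  rewrite -map_poly_comp; apply: eq_map_poly => a /=; exact: const_frac_tofrac.
by rewrite horner_map /= -/(p \Po 'X) comp_polyXr.
Qed.

Lemma coefs_baseP (h : {poly K}) :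
  coefs_in (@base_domain D) h <-> exists p, h = map_poly (@tofrac D) p.
Proof.
split=> [Dh|[p ->] i]; last by rewrite coef_map; exists p`_i.
have /choice[a ha] : forall i, exists a, tofrac a = h`_i.
  by move=> i; have [a _ ha] := Dh i; exists a.
exists (\poly_(i < size h) a i); apply/polyP => i; rewrite coef_map coef_poly.
by case: ltnP => [_|szi]; rewrite /= ?ha // nth_default ?tofrac0.
Qed.

Lemma common_denominator (h : {poly K}) :
  exists2 d : D, d != 0 & coefs_in (@base_domain D) (tofrac d *: h).
Proof.
elim/poly_ind: h => [|p c [d d0 dp]].
  by exists 1; rewrite ?oner_neq0 // scaler0; apply: coefs0; apply: base_submodule.
have [n [e [e0 ->]]] := fractionP c; exists (d * e); first exact: mulf_neq0.
have hB := base_submodule D.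
rewrite scalerDr tofracM; apply: coefsD => //.
  have -> : (tofrac d * tofrac e) *: (p * 'X) = tofrac e *: ('X * (tofrac d *: p)).
    by rewrite -!mul_polyC polyCM; ring.
  apply: coefsZ => //; first by exists e.
  by apply: coefsM => //; apply: (base_coefsX D 1).
rewrite -mul_polyC -polyCM -mulrA; apply: coefsC => //.
by rewrite [tofrac e * _]mulrC divfK ?tofrac_eq0 // -tofracM; exists (d * n).
Qed.

Lemma poly_frac_inj : injective poly_frac.
Proof.
apply: raddf_inj => h h0; have [d d0 /coefs_baseP[p dh]] := common_denominator h.
have d0' : tofrac d != 0 :> K by rewrite tofrac_eq0.
have : poly_frac (tofrac d *: h) = 0 by rewrite -mul_polyC rmorphM h0 mulr0.
rewrite dh poly_frac_tofrac => /eqP; rewrite tofrac_eq0 => /eqP p0.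
by apply: (scalerI d0'); rewrite dh p0 rmorph0 scaler0.
Qed.

Lemma base_poly_frac (h : {poly K}) :
  base_domain (poly_frac h) <-> coefs_in (@base_domain D) h.
Proof.
split=> [[p _ hp]|/coefs_baseP[p ->]]; last by rewrite poly_frac_tofrac; exists p.
by apply/coefs_baseP; exists p; apply: poly_frac_inj; rewrite poly_frac_tofrac.
Qed.

Lemma base_polyP (y : L) : base_domain y ->
  exists2 h, coefs_in (@base_domain D) h & y = poly_frac h.
Proof.
move=> [p _ <-]; exists (map_poly (@tofrac D) p); last by rewrite poly_frac_tofrac.
by apply/coefs_baseP; exists p.
Qed.

Lemma poly_frac_divC (y : L) (d : K) : d != 0 ->
  base_domain (const_frac d * y) -> exists h, y = poly_frac h.
Proof.
move=> d0 /base_polyP[h _ dy]; exists (d^-1 *: h).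
rewrite -mul_polyC rmorphM /= -[X in _ * X]dy poly_fracC mulrA -rmorphM.
by rewrite mulVf // rmorph1 mul1r.
Qed.

Lemma base_const_frac (c : K) : base_domain (const_frac c) <-> base_domain c.
Proof.
rewrite -poly_fracC base_poly_frac; split=> [/(_ 0%N)|Dc]; first by rewrite coefC.
by apply: coefsC => //; apply: base_submodule.
Qed.

(** Brings the w-operation of D[X] down to D: [F] joins the contents of the coefficients of [G],
    which are polynomials over D. A constant multiplying [F] into D[X] does the same to [G], so it
    lies in D. *)
Lemma unit_content_tofrac_family (G : {poly L}) : unit_content G ->
  exists2 F : {poly K}, unit_content F &
    forall (I : set K) h, is_submodule I ->
      (forall k g, poly_frac g = G`_k -> coefs_in I (g * h)) -> coefs_in I (F * h).
Proof.
move=> [DG G0 Gu].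
have /choice[g gP] : forall k, exists g : {poly K},
    coefs_in (@base_domain D) g /\ G`_k = poly_frac g.
  by move=> k; have [g Dg Gk] := base_polyP (DG k); exists g.
have [F [FJ Fh]] := join_content [seq g k | k <- iota 0 (size G)].
have FJg (J : set K) : J 0 -> coefs_in J F -> forall k, coefs_in J (g k).
  move=> J0 JF k; have [ltk|szk] := ltnP k (size G).
    by apply: (proj1 (FJ J J0) JF); apply: map_f; rewrite mem_iota.
  have -> : g k = 0.
    by apply: poly_frac_inj; rewrite rmorph0 -(proj2 (gP k)) nth_default.
  by move=> i; rewrite coef0.
exists F; last first.
  move=> I h hI gI; apply: Fh => // _ /mapP[k _ ->].
  by apply: (gI k); case: (gP k).
have hB := base_submodule D; split.
- by apply: (proj2 (FJ _ (submodule0 hB))) => _ /mapP[k _ ->]; case: (gP k).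
- apply: contra_neq G0 => F0; apply/polyP => k; rewrite coef0 (proj2 (gP k)).
  have -> : g k = 0; last by rewrite rmorph0.
  apply/polyP => i; rewrite coef0.
  by apply: (FJg [set 0]) => // j; rewrite F0 coef0.
- move=> w wF; apply/base_const_frac; apply: Gu => k.
  rewrite coefZ (proj2 (gP k)) -poly_fracC -rmorphM base_poly_frac mul_polyC => i.
  rewrite coefZ; apply: (FJg [set z | base_domain (w * z)]).
    by rewrite /= mulr0; apply: base0.
  by move=> j; rewrite /= -coefZ.
Qed.

Lemma w_divisorial_of_poly : w_divisorial_domain {poly D} -> w_divisorial_domain D.
Proof.
move=> wDX I [[hI [e e0 eI]] [b Ib b0] Iw].
have wI : w_closed I by rewrite /w_closed -w_closureE // -Iw.
have hB := base_submodule D.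
pose Q : set L := [set poly_frac h | h in coefs_in I].
have QE h : Q (poly_frac h) -> coefs_in I h by move=> [h' Ih' /poly_frac_inj <-].
have hQ : is_submodule Q.
  split=> [|_ _ [p Ip <-] [q Iq <-]|a _ [p Ip <-]].
  - by exists 0; [exact: coefs0 | rewrite rmorph0].
  - by exists (p + q); [exact: coefsD | rewrite rmorphD].
  - exists (map_poly (@tofrac D) a * p); last by rewrite rmorphM /= poly_frac_tofrac.
    by apply: coefsM => //; apply/coefs_baseP; exists a.
have e0K : tofrac e != 0 :> K by rewrite tofrac_eq0.
have eQ y : Q y -> base_domain (const_frac (tofrac e) * y).
  move=> [h Ih <-]; rewrite -poly_fracC -rmorphM base_poly_frac mul_polyC => i.
  by rewrite coefZ; apply: eI.
have fQ : fractional_ideal Q.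
  split=> //; exists e%:P; first by rewrite polyC_eq0.
  by move=> y /eQ; rewrite const_frac_tofrac.
have Qconst z : I z -> Q (const_frac z).
  by move=> Iz; exists z%:P; [exact: coefsC | exact: poly_fracC].
have Q0 : nonzero_set Q.
  by exists (const_frac b); [exact: Qconst | rewrite fmorph_eq0].
have [|_ _ Qv] := wDX Q.
  split=> //; rewrite w_closureE //; apply/seteqP; split; first exact: sub_w_hull.
  move=> y [G uG yG]; have [_ _ Gu] := uG.
  (* The denominator [e] of [I] gives e y G coefficients in D[X], so e y is in D[X] and [y] is a
     polynomial over K. *)
  have [h yE] : exists h, y = poly_frac h.
    apply: (poly_frac_divC e0K); apply: Gu => i.
    by rewrite coefZ -mulrA -coefZ; apply: eQ.
  have [F uF FI] := unit_content_tofrac_family uG.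
  exists h => //; apply: (coefs_in_divl hI wI uF); apply: FI => // k g gE.
  apply: QE; rewrite rmorphM /= gE -yE mulrC -coefZ; exact: yG.
split; [by split=> //; exists e | by exists b |].
apply/seteqP; split; first exact: sub_v_closure.
move=> x xv; suff : Q (poly_frac x%:P) by move/QE/(_ 0%N); rewrite coefC.
rewrite Qv => q Qq.
(* Since b q is in D[X], [q] is a polynomial; as it multiplies [I] into D[X], its coefficients lie
   in I^-1, which [x] multiplies into D. *)
have [h qE] : exists h, q = poly_frac h.
  by apply: (poly_frac_divC b0); rewrite mulrC; apply: Qq; apply: Qconst.
rewrite {}qE in Qq *; rewrite -rmorphM base_poly_frac mul_polyC => i.
rewrite coefZ; apply: xv => z Iz; rewrite mulrC -coefZ.
move: i; apply/base_poly_frac; rewrite -mul_polyC mulrC rmorphM /= poly_fracC.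
by apply: Qq; apply: Qconst.
Qed.

(* Dividing [Q] by an element of minimal degree and clearing denominators
   uniformly turns [Q] into an ideal of D[X] containing a nonzero constant. *)
Lemma w_divisorial_poly : mori_domain D -> w_divisorial_domain D ->
  w_divisorial_domain {poly D}.
Proof.
move=> mD wD Q [[hQ [e e0 eQ]] [q0 Qq0 q00] Qw].
have wQ : w_closed Q by rewrite /w_closed -w_closureE // -Qw.
have hB := base_submodule D; have wB := @base_w_closed D.
have e0L : tofrac e != 0 :> L by rewrite tofrac_eq0.
pose P (p : {poly D}) := Q (tofrac p / tofrac e).
have QP q : Q q -> exists2 p, P p & q = tofrac p / tofrac e.
  move=> Qq; have [p _ pE] := eQ q Qq.
  have qE : q = tofrac p / tofrac e by rewrite pE mulrC mulKf.
  by exists p; rewrite // /P -qE.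
have [f [Pf f0] fmin] : exists2 f, P f /\ f != 0 &
    forall p, P p -> p != 0 -> (size f <= size p)%N.
  have [p Pp pE] := QP q0 Qq0.
  have p0 : p != 0.
    by apply: contraNneq q00 => p0; rewrite pE p0 tofrac0 mul0r.
  pose R n := `[< exists f, [/\ P f, f != 0 & size f = n] >].
  have exR : exists n, R n by exists (size p); apply/asboolP; exists p.
  case: (ex_minnP exR) => n /asboolP[f [Pf f0 szf]] minn.
  by exists f => // r Pr r0; rewrite szf; apply: minn; apply/asboolP; exists r.
pose mu := map_poly (@tofrac D).
have f0K : mu f != 0 by rewrite map_poly_eq0_id0 // tofrac_eq0 lead_coef_eq0.
have [|d [Dd d0] dP] := bounded_denominators mD wD _ f0K.
  by apply/coefs_baseP; exists f.
pose c : L := tofrac f / tofrac e.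
have f0L : tofrac f != 0 :> L by rewrite tofrac_eq0.
have c0 : c != 0 := mulf_neq0 f0L (invr_neq0 e0L).
have Qc q : Q q -> exists2 h, q = c * poly_frac h &
    coefs_in (@base_domain D) (d *: h).
  move=> /QP[p Pp ->].
  (* The multiplier of pseudo-division; the remainder is again a numerator of an element of [Q], so
     minimality of deg f makes it zero. *)
  pose a := lead_coef f ^+ scalp p f.
  have a0 : a != 0 by rewrite expf_neq0 ?lead_coef_eq0.
  have pE : a *: p = p %/ f * f + p %% f := Pdiv.Idomain.divp_eq p f.
  have r0 : p %% f = 0.
    apply/eqP; apply: contraT => r0.
    have := fmin (p %% f); rewrite leqNgt Pdiv.Idomain.ltn_modp f0 => /(_ _ r0).
    have -> : p %% f = a%:P * p - (p %/ f) * f.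
      by rewrite mul_polyC pE addrC addKr.
    apply; rewrite /P tofracB mulrBl; apply: submoduleB => //.
      by rewrite tofracM -mulrA; apply: submoduleM => //; exists a%:P.
    by rewrite tofracM -mulrA; apply: submoduleM => //; exists (p %/ f).
  rewrite r0 addr0 in pE.
  have aK : tofrac a != 0 :> K by rewrite tofrac_eq0.
  pose h : {poly K} := (tofrac a)^-1 *: mu (p %/ f).
  have fh : mu f * h = mu p.
    apply: (scalerI aK); rewrite /h -scalerAr scalerA divff // scale1r -rmorphM.
    rewrite mulrC -pE -mul_polyC rmorphM /= /mu map_polyC mul_polyC //.
  exists h; last by apply: dP; rewrite fh; apply/coefs_baseP; exists p.
  have -> : tofrac p = poly_frac (mu f * h) by rewrite fh poly_frac_tofrac.
  by rewrite rmorphM /= poly_frac_tofrac mulrAC.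
have Qc1 : Q c := Pf.
clearbody c.
have d0L : const_frac d != 0 by rewrite fmorph_eq0.
(* [T] is (d/c) Q: it lies in D[X] by the choice of [d], and contains [d] since [c] is in [Q]. *)
pose T : set {poly K} := [set h | Q (c * poly_frac h / const_frac d)].
have TD : T `<=` coefs_in (@base_domain D).
  move=> h /Qc[h' chE dh'].
  have hE : poly_frac h = poly_frac h' * const_frac d.
    by apply: (mulfI c0); rewrite mulrA -chE divfK.
  apply/base_poly_frac; rewrite hE -poly_fracC -rmorphM base_poly_frac.
  by rewrite mulrC mul_polyC.
have Td : T d%:P by rewrite /T /= poly_fracC mulfK.
have hT : poly_submodule T.
  split=> [p q Tp Tq|r p Dr Tp]; rewrite /T /=.
    by rewrite rmorphD mulrDr mulrDl; apply: submoduleD.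
  by rewrite rmorphM mulrCA -mulrA; apply: submoduleM => //; apply/base_poly_frac.
have satT : content_saturated T.
  move=> g h ug Tgh; have [Dg _ _] := ug.
  have Dh : coefs_in (@base_domain D) h.
    by apply: (coefs_in_divl hB wB ug); apply: TD.
  (* Encodes the ideal (g, d) of D[X], whose inverse is D[X]: dividing by [d] leads into K[X], and
     [g] then cancels by unit content. *)
  pose G : {poly L} := (poly_frac g)%:P + (const_frac d) *: 'X.
  have G0 : G`_0 = poly_frac g by rewrite coefD coefC coefZ coefX mulr0 addr0.
  have G1 : G`_1 = const_frac d by rewrite coefD coefC coefZ coefX mulr1 add0r.
  have Gk k : G`_k.+2 = 0 by rewrite coefD coefC coefZ coefX mulr0 addr0.
  apply: wQ; exists G; last first.
    move=> [|[|k]]; rewrite coefZ ?G0 ?G1 ?Gk ?mulr0; last exact: submodule0.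
      move: Tgh; rewrite /T /= rmorphM /=; congr Q; ring.
    move: (proj2 hT _ _ Dh Td); rewrite /T /= rmorphM /= poly_fracC.
    by congr Q; ring.
  split=> [[|[|k]]||y yG].
  - by rewrite G0; apply/base_poly_frac.
  - by rewrite G1; apply/base_const_frac.
  - by rewrite Gk; apply: base0.
  - by apply: contraNneq d0L => G00; rewrite -G1 G00 coef0.
  have [h' yE] : exists h', y = poly_frac h'.
    by apply: (poly_frac_divC d0); have := yG 1%N; rewrite coefZ G1 mulrC.
  rewrite yE base_poly_frac; apply: (coefs_in_divl hB wB ug).
  rewrite -base_poly_frac mulrC rmorphM /= -yE -G0 -coefZ; exact: yG.
have divT := base_poly_divisorial mD wD Dd d0 hT satT Td TD.
split; [by split=> //; exists e | by exists q0 |].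
apply/seteqP; split; first exact: sub_v_closure.
move=> x xv.
(* Scaling by d/c carries the dual of [T] into Q^-1; taking p = 1 below shows that x d/c is a
   polynomial, to which [divT] applies. *)
have Tinv p : poly_dual T p -> inv_ideal Q (poly_frac p * (const_frac d / c)).
  move=> pT q Qq; have [h qE _] := Qc q Qq.
  have Tdh : T (d *: h).
    by rewrite /T /= -mul_polyC rmorphM /= poly_fracC mulrCA -qE mulrAC divff ?mul1r.
  have -> : poly_frac p * (const_frac d / c) * q = poly_frac (p * (d *: h)).
    rewrite -mul_polyC !rmorphM /= poly_fracC qE -mulrA; congr (_ * _).
    by rewrite mulrA (divfK c0).
  by apply/base_poly_frac; apply: pT.
have T1 : poly_dual T 1 by move=> t /TD; rewrite mul1r.
have [t Dt tE] : exists2 t, coefs_in (@base_domain D) t &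
    x * (const_frac d / c) = poly_frac t.
  by apply: base_polyP; have := xv _ (Tinv 1 T1); rewrite rmorph1 mul1r.
have xE : x = c * poly_frac t / const_frac d.
  by rewrite -tE mulrCA [c * _]mulrC (divfK c0) (mulfK d0L).
rewrite xE; apply: divT => p pT.
apply/base_poly_frac; rewrite rmorphM /= -tE -mulrA.
by rewrite [const_frac d / c * _]mulrC; apply: xv; apply: Tinv.
Qed.

End PolynomialRing.

Theorem proposition3p6 (D : idomainType) (hD : mori_domain D) :
  w_divisorial_domain D <-> w_divisorial_domain {poly D}.
Proof.
by split; [exact: w_divisorial_poly | exact: w_divisorial_of_poly].
Qed.
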